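(* For all $n \geq 1$, \[ A_n(u,v) = \sum_{e \in \mathbb{I}_n} u^{\mathrm{asc}(e)} v^{\mathrm{row}(e)}, \] where $A_n(u,v) = \sum_{\pi\in\mathbb{S}_n} u^{\mathrm{des}(\pi)}v^{\mathrm{des}(\pi^{-1})}$ is the double Eulerian polynomial.
   Context: Permutations $w \in \mathbb{S}_n$ are identified with words $w_1\dots w_n$. The descent set of $w$ is $\mathrm{DES}(w) = \{i : w_i > w_{i+1}\}$ and $\mathrm{des}(w) = \#\mathrm{DES}(w)$ is its number of descents. An inversion table of length $n$ is a sequence $e = e_1\dots e_n$ of positive integers with $1 \leq e_i \leq i$ for all $i$ (so $e_1 = 1$); $\mathbb{I}_n$ denotes the set of inversion tables of length $n$. For $e \in \mathbb{I}_n$ define $\mathrm{ASC}(e) = \{i : e_i < e_{i+1}\}$ (strict inequality) and $\mathrm{ROW}(e) = \{e_i : 1 \leq i \leq n\} \setminus \{1\}$, and let $\mathrm{asc}(e) = \#\mathrm{ASC}(e)$ and $\mathrm{row}(e) = \#\mathrm{ROW}(e)$. *)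

(* Defs.v *)
From mathcomp Require Import all_boot all_order all_fingroup all_algebra.
From mathcomp Require Import mpoly.
Set Implicit Arguments.
Unset Strict Implicit.
Unset Printing Implicit Defensive.

(* Positions are 0-based: the element i of 'I_n stands for the
   position i.+1 of a word of length n. Letters of permutations are shifted
   down by one as well, which changes no comparison between them; entries of
   inversion tables keep their original values, which are at most n and hence
   live in 'I_n.+1. *)

Definition DES n (w : 'S_n) : {set 'I_n} :=
  [set i : 'I_n | [exists j : 'I_n, (j == i.+1 :> nat) && (w j < w i)%N]].

Definition des n (w : 'S_n) : nat := #|DES w|.

Definition inv_tables n : {set {ffun 'I_n -> 'I_n.+1}} :=
  [set e : {ffun 'I_n -> 'I_n.+1} | [forall i : 'I_n, (1 <= e i <= i.+1)%N]].

Definition ASC n (e : {ffun 'I_n -> 'I_n.+1}) : {set 'I_n} :=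
  [set i : 'I_n | [exists j : 'I_n, (j == i.+1 :> nat) && (e i < e j)%N]].

Definition asc n (e : {ffun 'I_n -> 'I_n.+1}) : nat := #|ASC e|.

Definition ROW n (e : {ffun 'I_n -> 'I_n.+1}) : {set 'I_n.+1} :=
  [set k in [set e i | i : 'I_n] | k != 1%N :> nat].

(* The statistic row(e), renamed because [row] is the matrix row. *)
Definition nrow n (e : {ffun 'I_n -> 'I_n.+1}) : nat := #|ROW e|.

(* The variables u and v are 'X_0 and 'X_1. *)
Definition double_eulerian n : {mpoly int[2]} :=
  (\sum_(w : 'S_n) 'X_0 ^+ des w * 'X_1 ^+ des (w^-1)%g)%R.

(* Main.v *)
(** Both kinds of objects are grown one letter at a time. A permutation of size
    n grows by appending a last value, chosen among the n + 1 gaps between the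
    present values, gaps being numbered 0, ..., n from the top; an inversion
    table of length n grows by appending the entry r + 1 with r in 0, ..., n.
    Choosing r after q creates a descent (resp. an ascent) iff q < r, and it
    increases des(w^-1) (resp. row) by one unless r is "free": the free gaps are
    the top one and those between values i, i+1 with i in DES(w^-1), while r is
    free for a table iff r + 1 already occurs. There are always
    des(w^-1) + 1 (resp. row + 1) free choices.

    The free sets evolve differently: a gap split by the new value shifts the
    gaps below it. However, weighting a step by
    u^[q < r] = (1 - u) [r <= q] + u, the total weight of all m-step growths
    only depends on the number a of free and b of non-free choices <= q and on the
    total number k of free choices. Indeed, summing over r <= q one choice at a
    time gives two recursions, according to whether the last choice is free,
    and these two recursions commute. *)
Require Import Defs.
From mathcomp Require Import all_boot all_order all_fingroup all_algebra.
From mathcomp Require Import mpoly zify ring.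
Set Implicit Arguments.
Unset Strict Implicit.
Unset Printing Implicit Defensive.
Import GRing.Theory.
Local Open Scope ring_scope.

(** * Weighted growth over an abstract set of free choices *)

Definition count_below (F : pred nat) (n : nat) : nat := (\sum_(i < n) F i)%N.

Lemma count_belowS (F : pred nat) (n : nat) :
  count_below F n.+1 = (count_below F n + F n)%N.
Proof. exact: big_ord_recr. Qed.

Lemma count_below_le (F : pred nat) (n : nat) : (count_below F n <= n)%N.
Proof.
elim: n => [|n IHn]; first by rewrite /count_below big_ord0.
by rewrite count_belowS; case: (F n); lia.
Qed.

Lemma eq_count_below (F G : pred nat) (n : nat) :
  (forall j, (j < n)%N -> F j = G j) -> count_below F n = count_below G n.
Proof. by move=> FG; apply: eq_bigr => i _; rewrite FG. Qed.

(* The sum of the weights [f] of the states reached by choosing some r <= q,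
   from the state (a, b, k), when the [a] free choices come first and the [b]
   non-free ones next; by [next_sum_free] the order is irrelevant. After
   choosing r, the choices <= r are r, now free, and the former ones < r. *)
Definition next_sum (R : pzRingType) (f : nat -> nat -> nat -> R)
    (a b k : nat) : R :=
  \sum_(i < a) f i.+1 0 k + \sum_(j < b) f a.+1 j k.+1.

(** The second [next_sum] runs over all [n.+1] choices. The final exponent is [k.-1] because free
    choices outnumber the statistic marked by [v] by one. *)
Fixpoint growth (R : pzRingType) (u v : R) (m n a b k : nat) : R :=
  if m is m'.+1 then
    (1 - u) * next_sum (growth u v m' n.+1) a b k
      + u * next_sum (growth u v m' n.+1) k (n.+1 - k) k
  else v ^+ k.-1.

Lemma next_sum_nonfree (R : pzRingType) (f : nat -> nat -> nat -> R)
    (a b k : nat) :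
  next_sum f a b.+1 k = next_sum f a b k + f a.+1 b k.+1.
Proof. by rewrite /next_sum big_ord_recr addrA. Qed.

(* The condition on [f] under which the recursions [next_sum_nonfree] and
   [next_sum_free] commute. *)
Definition exchangeable (R : pzRingType) (f : nat -> nat -> nat -> R) : Prop :=
  forall a b k,
    f a.+1 b.+1 k - f a.+1 b k = f a.+2 b k.+1 - f a.+1 b k.+1.

Lemma next_sum_free (R : comPzRingType) (f : nat -> nat -> nat -> R)
    (a b k : nat) :
  exchangeable f -> next_sum f a.+1 b k = next_sum f a b k + f a.+1 b k.
Proof.
move=> exf; elim: b => [|b IHb].
  by rewrite /next_sum !big_ord0 !addr0 big_ord_recr.
rewrite !next_sum_nonfree IHb.
have /eqP := exf a b k; rewrite subr_eq => /eqP ->.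
ring.
Qed.

(** With a step to make, both differences equal [1 - u] times the next [growth] at [a.+2], [b],
    [k.+1]: one adds a non-free choice, the other a free one. The terms in [u] depend only on [k]
    and cancel. *)
Lemma growth_exchangeable (R : comPzRingType) (u v : R) (m n : nat) :
  exchangeable (growth u v m n).
Proof.
elim: m n => [|m IHm] n a b k /=; first by rewrite !subrr.
rewrite next_sum_nonfree [next_sum _ a.+2 _ _]next_sum_free //.
ring.
Qed.

Definition state_growth (R : pzRingType) (u v : R) (m n q : nat)
    (F : pred nat) : R :=
  growth u v m n (count_below F q.+1) (q.+1 - count_below F q.+1)
    (count_below F n.+1).

(* [G] is the set of free choices after choosing [r] in a state of size [n] with
   free choices [F]. Nothing is said about which choices above [r] are free. *)
Definition extends_free (n : nat) (F : pred nat) (r : nat) (G : pred nat) :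
    Prop :=
  [/\ forall j, (j < r)%N -> G j = F j, G r
    & count_below G n.+2 = (count_below F n.+1 + ~~ F r)%N].

Lemma sum_state_growth (R : comPzRingType) (u v : R) (m n t : nat)
    (F : pred nat) (G : nat -> pred nat) :
  (forall r, (r < t)%N -> extends_free n F r (G r)) ->
  \sum_(r < t) state_growth u v m n.+1 r (G r) =
  next_sum (growth u v m n.+1) (count_below F t) (t - count_below F t)
    (count_below F n.+1).
Proof.
elim: t => [|t IHt] FG.
  by rewrite big_ord0 /next_sum /count_below !big_ord0 addr0.
rewrite big_ord_recr /= IHt => [|r rt]; last exact/FG/(leq_trans rt).
have [Glt Gt GN] := FG t (leqnn _).
rewrite /state_growth GN !count_belowS (eq_count_below Glt) Gt addn1 subSS.
have le := count_below_le F t.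
case: (F t) => /=.
  by rewrite addn0 addn1 subSS next_sum_free //; apply: growth_exchangeable.
by rewrite addn0 addn1 subSn // next_sum_nonfree.
Qed.

Lemma state_growth_rec (R : comPzRingType) (u v : R) (m n q : nat)
    (F : pred nat) (G : nat -> pred nat) :
  (q <= n)%N -> (forall r, (r <= n)%N -> extends_free n F r (G r)) ->
  \sum_(r < n.+1) u ^+ (q < r)%N * state_growth u v m n.+1 r (G r) =
  state_growth u v m.+1 n q F.
Proof.
move=> qn FG; rewrite [RHS]/state_growth /=.
rewrite -(@sum_state_growth _ u v m n q.+1 F G); last first.
  by move=> r rq; apply: FG; lia.
rewrite -(@sum_state_growth _ u v m n n.+1 F G) //.
rewrite (big_ord_widen n.+1 (fun r => state_growth u v m n.+1 r (G r))) //.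
rewrite [X in _ = _ * X + _]big_mkcond !mulr_sumr -big_split.
apply: eq_bigr => r _.
by rewrite /= ltnS; case: leqP => _; rewrite (expr0, expr1); ring.
Qed.

Lemma card_adjacent (n : nat) (r : rel 'I_n.+1) :
  #|[set i : 'I_n.+1 | [exists j : 'I_n.+1, (j == i.+1 :> nat) && r i j]]| =
  (\sum_(i < n) r (widen_ord (leqnSn n) i) (lift ord0 i))%N.
Proof.
rewrite -sum1dep_card big_mkcond big_ord_recr /=.
rewrite [X in (_ + X)%N]ifF; last first.
  apply/existsP => -[j /andP[/eqP jn _]].
  by have := ltn_ord j; rewrite jn ltnn.
rewrite addn0; apply: eq_bigr => i _.
rewrite (_ : [exists j, _] = r (widen_ord (leqnSn n) i) (lift ord0 i)).
  by case: (r _ _).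
apply/existsP/idP => [[j /andP[/eqP jn]]|rij].
  by congr (r _ _); apply: val_inj.
by exists (lift ord0 i); rewrite eqxx.
Qed.


(** * Growth of permutations by a last letter *)

Lemma sum_perm_append (R : nmodType) (n : nat) (f : 'S_n.+1 -> R) :
  \sum_(w : 'S_n.+1) f w =
  \sum_(w : 'S_n) \sum_(r < n.+1) f (lift_perm ord_max (rev_ord r) w).
Proof.
rewrite pair_bigA /=; apply: reindex.
apply/onW_bij/inj_card_bij => [[w r] [w' r'] /= ww'|]; last first.
  by rewrite card_prod !card_Sn card_ord factS mulnC.
have rr' : r = r'.
  apply: rev_ord_inj.
  by rewrite -(lift_perm_id ord_max (rev_ord r) w) ww' lift_perm_id.
rewrite -rr' in ww' *; congr (_, _); apply/permP => i.
by apply: (@lift_inj _ (rev_ord r)); rewrite -!(lift_perm_lift ord_max) ww'.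
Qed.

Definition top_gap (n : nat) (w : 'S_n.+1) : nat := n - w ord_max.

(* The 1-based position of the j-th largest value. The convention 0 at j = 0
   acts as a value above all others placed in front, and makes the top gap free; the
   value 0 beyond the last letter makes the bottom gap non-free. *)
Definition letter_pos (n : nat) (w : 'S_n.+1) (j : nat) : nat :=
  if j is j'.+1 then
    if (j' <= n)%N then ((w^-1)%g (inord (n - j'))).+1 else 0
  else 0.

(** Of two consecutive values the larger comes first exactly when the smaller is a descent of
    [w^-1]. *)
Definition free_gap (n : nat) (w : 'S_n.+1) : pred nat :=
  fun j => (letter_pos w j < letter_pos w j.+1)%N.

Lemma letter_pos_le (n : nat) (w : 'S_n.+1) (j : nat) :
  (letter_pos w j <= n.+1)%N.
Proof. by case: j => //= j; case: ifP. Qed.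

Lemma letter_pos_append (n : nat) (w : 'S_n.+1) (r : 'I_n.+2) :
  let w' := lift_perm ord_max (rev_ord r) w in
  [/\ forall j, (j <= r)%N -> letter_pos w' j = letter_pos w j,
      letter_pos w' r.+1 = n.+2
    & forall j, (r < j)%N -> letter_pos w' j.+1 = letter_pos w j].
Proof.
have rn := ltn_ord r; rewrite /=; split=> [[|j] //= jr||[|j] //=].
- rewrite !ifT ?lift_permV; try lia.
  rewrite (_ : inord (n.+1 - j) = lift (rev_ord r) (inord (n - j))).
    by rewrite lift_perm_lift lift_max.
  by apply: val_inj; rewrite /= /bump !inordK; lia.
- rewrite ifT ?lift_permV; last lia.
  rewrite (_ : inord (n.+1 - r) = rev_ord r) ?lift_perm_id //.
  by apply: val_inj; rewrite /= inordK; lia.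
- rewrite !ltnS => rj; case: ifP => // jn; rewrite lift_permV.
  rewrite (_ : inord (n.+1 - j.+1) = lift (rev_ord r) (inord (n - j))).
    by rewrite lift_perm_lift lift_max.
  by apply: val_inj; rewrite /= /bump !inordK; lia.
Qed.

(** The entry [F r] is replaced by true followed by false, which raises the count unless [F r]
    holds. *)
Lemma count_below_insert (F G : pred nat) (r t : nat) :
  (forall j, (j < r)%N -> G j = F j) -> G r -> G r.+1 = false ->
  (forall j, (r < j)%N -> G j.+1 = F j) -> (r < t)%N ->
  count_below G t.+1 = (count_below F t + ~~ F r)%N.
Proof.
move=> Glt Gr GSr Ggt; elim: t => // t IHt; rewrite ltnS leq_eqVlt.
case/predU1P => [<-|rt].
  by rewrite !count_belowS GSr Gr (eq_count_below Glt); case: (F r) => /=; lia.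
by rewrite count_belowS IHt // Ggt // count_belowS addnAC.
Qed.

Lemma free_gap_append (n : nat) (w : 'S_n.+1) (r : 'I_n.+2) :
  extends_free n.+1 (free_gap w) r
    (free_gap (lift_perm ord_max (rev_ord r) w)).
Proof.
have [plt pr pgt] := letter_pos_append w r; rewrite /free_gap; split.
- by move=> j jr; rewrite !plt // ltnW.
- by rewrite pr plt // ltnS letter_pos_le.
apply: count_below_insert => //.
- by move=> j jr; rewrite !plt // ltnW.
- by rewrite pr plt // ltnS letter_pos_le.
(* The new value stands last, so the gap just below it is not free. *)
- by rewrite pr pgt // ltnNge (leq_trans (letter_pos_le _ _)).
- by move=> j jr; rewrite !pgt // (leq_trans jr).
Qed.

Lemma widen_lift_max (n : nat) (i : 'I_n) :
  widen_ord (leqnSn n) i = lift ord_max i.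
Proof. by apply: val_inj; rewrite /= /bump; have := ltn_ord i; lia. Qed.

Lemma lift0_lift_max (n : nat) (i : 'I_n) :
  lift ord0 (lift ord_max i) = lift ord_max (lift ord0 i) :> 'I_n.+2.
Proof. by apply: val_inj; rewrite /= /bump /=; have := ltn_ord i; lia. Qed.

Lemma des_sum (n : nat) (w : 'S_n.+1) :
  des w =
  (\sum_(i < n) (w (lift ord0 i) < w (widen_ord (leqnSn n) i))%N)%N.
Proof. exact: (card_adjacent (fun i j => w j < w i)%N). Qed.

Lemma des_append (n : nat) (w : 'S_n.+1) (r : 'I_n.+2) :
  des (lift_perm ord_max (rev_ord r) w) = (des w + (top_gap w < r))%N.
Proof.
rewrite !des_sum big_ord_recr /=.
congr (_ + _)%N.
  apply: eq_bigr => i _; rewrite !widen_lift_max lift0_lift_max.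
  rewrite !lift_perm_lift /= /bump; lia.
rewrite widen_lift_max lift_perm_lift.
rewrite (_ : lift ord0 ord_max = ord_max); last exact: val_inj.
rewrite lift_perm_id /= /bump /top_gap.
have := ltn_ord (w ord_max); have := ltn_ord r; lia.
Qed.

Lemma top_gap_append (n : nat) (w : 'S_n.+1) (r : 'I_n.+2) :
  top_gap (lift_perm ord_max (rev_ord r) w) = r.
Proof. by rewrite /top_gap lift_perm_id /=; have := ltn_ord r; lia. Qed.

Lemma count_free_gap (n : nat) (w : 'S_n.+1) :
  count_below (free_gap w) n.+2 = (des (w^-1)%g).+1.
Proof.
(* The top gap, always free, and the bottom gap, never free, are split off. Gaps count from the top,
   hence the reversal. *)
rewrite /count_below big_ord_recl big_ord_recr des_sum /free_gap /= ltnn.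
rewrite addn0 add1n; congr _.+1; rewrite (reindex_inj rev_ord_inj).
apply: eq_bigr => i _ /=; have ni := ltn_ord i.
rewrite /bump /= !add1n !ifT; try lia.
rewrite ltnS (_ : inord _ = lift ord0 i).
  rewrite (_ : inord _ = widen_ord (leqnSn n) i) //.
  by apply: val_inj; rewrite /= inordK; lia.
by apply: val_inj; rewrite /= /bump inordK; lia.
Qed.

(** Each last letter is traded for one more step of growth, until only the permutation of size 1 is
    left, in state [1], [0], [1]. *)
Lemma sum_perm_growth (R : comPzRingType) (u v : R) (n m : nat) :
  \sum_(w : 'S_n.+1)
    u ^+ des w * state_growth u v m n.+1 (top_gap w) (free_gap w) =
  growth u v (m + n) 1 1 0 1.
Proof.
elim: n m => [|n IHn] m.
  rewrite (big_pred1 1%g) => [|w]; last first.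
    by apply/esym/eqP/permP => i; rewrite !ord1.
  rewrite /state_growth count_free_gap invg1 des_sum big_ord0 expr0 mul1r addn0.
  rewrite /top_gap sub0n count_belowS /count_below big_ord0.
  by rewrite /free_gap.
rewrite addnS -addSn -IHn sum_perm_append; apply: eq_bigr => w _.
rewrite -(@state_growth_rec _ u v m n.+1 _ (free_gap w)
  (fun r => free_gap (lift_perm ord_max (rev_ord (inord r : 'I_n.+2)) w))).
- rewrite mulr_sumr; apply: eq_bigr => r _.
  by rewrite des_append top_gap_append inord_val exprD mulrA.
- by rewrite /top_gap; lia.
- by move=> r rn; have := free_gap_append w (inord r); rewrite inordK.
Qed.

(** * Growth of inversion tables by a last entry *)

Definition table_append (n : nat) (e : {ffun 'I_n -> 'I_n.+1}) (r : 'I_n.+1) :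
    {ffun 'I_n.+1 -> 'I_n.+2} :=
  [ffun i => if unlift ord_max i is Some j
             then widen_ord (leqnSn n.+1) (e j) else lift ord0 r].

Lemma table_append_max (n : nat) (e : {ffun 'I_n -> 'I_n.+1}) (r : 'I_n.+1) :
  table_append e r ord_max = lift ord0 r.
Proof. by rewrite ffunE unlift_none. Qed.

Lemma table_append_lift (n : nat) (e : {ffun 'I_n -> 'I_n.+1}) (r : 'I_n.+1)
    (i : 'I_n) :
  table_append e r (lift ord_max i) = widen_ord (leqnSn n.+1) (e i).
Proof. by rewrite ffunE liftK. Qed.

Lemma inv_tables_append (n : nat) (e : {ffun 'I_n -> 'I_n.+1}) (r : 'I_n.+1) :
  (table_append e r \in inv_tables n.+1) = (e \in inv_tables n).
Proof.
rewrite !inE; apply/forallP/forallP => he i.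
  by have := he (lift ord_max i); rewrite table_append_lift lift_max.
case: (unliftP ord_max i) => [j|] ->.
  by rewrite table_append_lift lift_max; apply: he.
by rewrite table_append_max /= /bump; have := ltn_ord r; lia.
Qed.

Lemma sum_inv_tables_append (R : nmodType) (n : nat)
    (f : {ffun 'I_n.+1 -> 'I_n.+2} -> R) :
  \sum_(e in inv_tables n.+1) f e =
  \sum_(e in inv_tables n) \sum_(r < n.+1) f (table_append e r).
Proof.
pose restr (e : {ffun 'I_n.+1 -> 'I_n.+2}) : {ffun 'I_n -> 'I_n.+1} :=
  [ffun i => inord (e (lift ord_max i))].
rewrite pair_big /=.
rewrite (reindex_onto (fun p => table_append p.1 p.2)
  (fun e => (restr e, inord (e ord_max).-1))) /=.
  apply: eq_bigl => -[e r] /=; rewrite inv_tables_append andbT.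
  rewrite [X in _ && X](_ : _ = true) ?andbT //; apply/eqP; congr (_, _).
    by apply/ffunP => i; rewrite ffunE table_append_lift inord_val.
  by rewrite table_append_max /= inord_val.
(* Both [inord] are faithful here: entries before the last are at most [n], and the last lies
   between [1] and [n.+1]. *)
move=> e; rewrite inE => /forallP he; apply/ffunP => i.
apply: val_inj; have := he i.
case: (unliftP ord_max i) => [j|] ->.
  rewrite table_append_lift lift_max /= ffunE => /andP[_ le].
  by rewrite inordK // ltnS (leq_trans le).
by rewrite table_append_max /= /bump => ?; rewrite inordK; lia.
Qed.

Definition occurs (n : nat) (e : {ffun 'I_n -> 'I_n.+1}) : pred nat :=
  fun j => [exists i, e i == j.+1 :> nat].

Lemma occurs_append (n : nat) (e : {ffun 'I_n -> 'I_n.+1}) (r : 'I_n.+1)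
    (j : nat) :
  occurs (table_append e r) j = occurs e j || (j == r).
Proof.
apply/existsP/orP => [[i]|[/existsP[i ei]|/eqP ->]].
- case: (unliftP ord_max i) => [k|] ->.
    by rewrite table_append_lift => ek; left; apply/existsP; exists k.
  by rewrite table_append_max /= /bump add1n eqSS eq_sym; right.
- by exists (lift ord_max i); rewrite table_append_lift.
- by exists ord_max; rewrite table_append_max.
Qed.

Lemma occurs_ge (n : nat) (e : {ffun 'I_n -> 'I_n.+1}) (j : nat) :
  (n <= j)%N -> occurs e j = false.
Proof. by move=> nj; apply/existsP => -[i]; have := ltn_ord (e i); lia. Qed.

(** Unlike the splitting of a gap, a new entry shifts no other choice. *)
Lemma count_below_add1 (F G : pred nat) (r t : nat) :
  (forall j, G j = F j || (j == r)) -> (r < t)%N ->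
  count_below G t = (count_below F t + ~~ F r)%N.
Proof.
move=> GF; elim: t => // t IHt; rewrite ltnS leq_eqVlt.
case/predU1P => [<-|rt].
  rewrite !count_belowS GF eqxx orbT (@eq_count_below G F r).
    by case: (F r) => /=; lia.
  by move=> j jt; rewrite GF ltn_eqF ?orbF.
by rewrite !count_belowS IHt // GF [t == r]gtn_eqF // orbF addnAC.
Qed.

Lemma occurs_extends (n : nat) (e : {ffun 'I_n -> 'I_n.+1}) (r : 'I_n.+1) :
  extends_free n (occurs e) r (occurs (table_append e r)).
Proof.
split.
- by move=> j jr; rewrite occurs_append ltn_eqF ?orbF.
- by rewrite occurs_append eqxx orbT.
rewrite count_belowS occurs_ge // addn0.
by apply: count_below_add1 => [j|]; [apply: occurs_append | apply: ltn_ord].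
Qed.

Lemma asc_sum (n : nat) (e : {ffun 'I_n.+1 -> 'I_n.+2}) :
  asc e =
  (\sum_(i < n) (e (widen_ord (leqnSn n) i) < e (lift ord0 i))%N)%N.
Proof. exact: (card_adjacent (fun i j => e i < e j)%N). Qed.

Lemma asc_append (n : nat) (e : {ffun 'I_n.+1 -> 'I_n.+2}) (r : 'I_n.+2) :
  e \in inv_tables n.+1 ->
  asc (table_append e r) = (asc e + ((e ord_max).-1 < r))%N.
Proof.
(* The last entry is positive, so [.-1] does not truncate. *)
rewrite inE => /forallP /(_ ord_max) /andP[emax _].
rewrite !asc_sum big_ord_recr /=; congr (_ + _)%N.
  apply: eq_bigr => i _; rewrite !widen_lift_max lift0_lift_max.
  by rewrite !table_append_lift.
rewrite widen_lift_max table_append_lift.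
rewrite (_ : lift ord0 ord_max = ord_max); last exact: val_inj.
by rewrite table_append_max /= /bump; lia.
Qed.

(** The extra one is the value 1, always the first entry and left out of [ROW]. *)
Lemma count_occurs (n : nat) (e : {ffun 'I_n.+1 -> 'I_n.+2}) :
  e \in inv_tables n.+1 -> count_below (occurs e) n.+2 = (nrow e).+1.
Proof.
rewrite inE => /forallP he.
rewrite count_belowS occurs_ge // addn0.
pose img := [set e i | i : 'I_n.+1].
have occE (k : 'I_n.+1) : occurs e k = (lift ord0 k \in img).
  apply/existsP/imsetP => [[i /eqP ei]|[i _ ei]].
    by exists i => //; apply: val_inj; rewrite /= ei.
  by exists i; rewrite -ei.
have img0 : ord0 \notin img.
  by apply/imsetP => -[i _ ei]; have := he i; rewrite -ei.
pose one : 'I_n.+2 := lift ord0 ord0.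
have img1 : one \in img.
  apply/imsetP; exists ord0 => //; apply: val_inj.
  by have := he ord0 => /=; rewrite /bump; lia.
have rowE : nrow e = #|img :\ one|.
  by apply: eq_card => k; rewrite in_setD1 inE andbC -val_eqE.
have := cardsD1 one img; rewrite img1 add1n rowE => <-.
rewrite /count_below -sum1_card [RHS]big_mkcond [RHS]big_ord_recl ifN //= add0n.
by apply: eq_bigr => k _; rewrite occE; case: ifP.
Qed.

Lemma sum_table_growth (R : comPzRingType) (u v : R) (n m : nat) :
  \sum_(e : {ffun 'I_n.+1 -> 'I_n.+2} | e \in inv_tables n.+1)
    u ^+ asc e * state_growth u v m n.+1 (e ord_max).-1 (occurs e) =
  growth u v (m + n) 1 1 0 1.
Proof.
elim: n m => [|n IHn] m.
  pose e1 : {ffun 'I_1 -> 'I_2} := [ffun _ => ord_max].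
  have occ0 : occurs e1 0 by apply/existsP; exists ord0; rewrite ffunE.
  rewrite (big_pred1 e1) => [|e]; last first.
    rewrite inE; apply/forallP/eqP => [he|-> i]; last by rewrite ffunE.
    apply/ffunP => i; apply: val_inj; rewrite ffunE.
    by have := he i; have := ltn_ord (e i); rewrite (ord1 i) /=; lia.
  rewrite asc_sum big_ord0 expr0 mul1r addn0 /state_growth ffunE !count_belowS.
  by rewrite occ0 occurs_ge // /count_below big_ord0.
rewrite addnS -addSn -IHn sum_inv_tables_append; apply: eq_bigr => e he.
rewrite -(@state_growth_rec _ u v m n.+1 _ (occurs e)
  (fun r => occurs (table_append e (inord r)))).
- rewrite mulr_sumr; apply: eq_bigr => r _.
  by rewrite asc_append // table_append_max inord_val exprD mulrA.
- by rewrite (leq_trans (leq_pred _)) // -ltnS ltn_ord.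
- by move=> r rn; have := occurs_extends e (inord r); rewrite inordK.
Qed.

Theorem theorem1 (n : nat) (hn : (1 <= n)%N) :
  double_eulerian n = \sum_(e in inv_tables n) 'X_0 ^+ asc e * 'X_1 ^+ nrow e.
Proof.
case: n hn => // n _; rewrite /double_eulerian.
(* For [m = 0] the remaining growth of each object is just its power of ['X_1]. *)
transitivity (growth ('X_0 : {mpoly int[2]}) 'X_1 (0 + n) 1 1 0 1).
  rewrite -sum_perm_growth; apply: eq_bigr => w _.
  by rewrite /state_growth /= count_free_gap.
rewrite -sum_table_growth; apply: eq_bigr => e he.
by rewrite /state_growth /= count_occurs.
Qed.
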